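(* Let $\boldsymbol{\hat\omega}=(\hat P^{-1},\hat Q,\hat W)$ be a Sturm-Liouville equation of Atkinson type and let $A=(A_1,A_2)$, $B=(B_1,B_2)$ be $2d\times2d$ complex matrices ($A_j,B_j$ being $2d\times d$) with $\operatorname{rank}(A,B)=2d$ and $AB^*=BA^*$. (1) The problem $$-\nabla(\hat P_{i+1}\Delta u_i)+\hat Q_iu_i=\lambda\hat W_iu_i,\ 0\le i\le N,\qquad A\begin{pmatrix}-u_0\\ u_N\end{pmatrix}+B\begin{pmatrix}\Delta u_{-1}\\ \Delta u_N\end{pmatrix}=0\qquad(\mathrm D)$$ is a self-adjoint discrete Sturm-Liouville problem. That is, all $\hat P_j$, $\hat Q_i$, $\hat W_i$ are Hermitian, $\hat P_j$ is invertible ($0\le j\le N+1$), $\hat W_i$ is positive definite ($0\le i\le N$), and the boundary condition, written equivalently in the standard form $$(A_1,A_2)\begin{pmatrix}-u_{-1}\\ u_N\end{pmatrix}+(B_1-A_1,B_2)\begin{pmatrix}\Delta u_{-1}\\ \Delta u_N\end{pmatrix}=0,$$ satisfies $\operatorname{rank}(A_1,A_2,B_1-A_1,B_2)=2d$ and $(A_1,A_2)(B_1-A_1,B_2)^*=(B_1-A_1,B_2)(A_1,A_2)^*$. (2) The continuous problem $$-(\hat Py')'+\hat Qy=\lambda\hat Wy\ \text{ on }(a,b),\qquad A\begin{pmatrix}-y(a)\\ y(b)\end{pmatrix}+B\begin{pmatrix}(\hat Py')(a)\\ (\hat Py')(b)\end{pmatrix}=0\qquad(\mathrm C)$$ is equivalent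 to (D). That is, for every $\lambda\in\mathbb C$, if $(u,v)=(y,\hat Py')$ solves (C), then $u$ is constant on each $[a_i,b_i]$, and the sequence $\{u_i\}_{i=-1}^{N+1}$, where $u_i$ is the value of $u$ on $[a_i,b_i]$ ($0\le i\le N$), $u_{-1}=u_0-v(a)$ and $u_{N+1}=u_N+v(b)$, solves (D). Conversely, every solution of (D) arises in this way from a solution of (C).
   Context: Let $d\ge1$, $N>1$. The equation $-(\hat Py')'+\hat Qy=\lambda\hat Wy$ is understood as the first-order system $u'=\hat P^{-1}v$, $v'=(\hat Q-\lambda\hat W)u$ with $u=y$, $v=\hat Py'$, where $\hat P^{-1},\hat Q,\hat W$ are integrable Hermitian $d\times d$ matrix-valued functions on $(a,b)$. It is of Atkinson type if there is a partition $a=a_0<b_0<a_1<b_1<\cdots<a_N<b_N=b$ such that: $\hat P^{-1}\equiv0$ on $[a_i,b_i]$ and $\hat W_i:=\int_{a_i}^{b_i}\hat W(s)\,ds$ is positive definite for $0\le i\le N$; and $\hat Q\equiv\hat W\equiv0$ on $[b_{j-1},a_j]$ and $\hat P_j^{-1}:=\int_{b_{j-1}}^{a_j}\hat P^{-1}(s)\,ds$ is invertible (with inverse denoted $\hat P_j$) for $1\le j\le N$. Put $\hat Q_i=\int_{a_i}^{b_i}\hat Q(s)\,ds$ for $0\le i\le N$, and $\hat P_0=\hat P_{N+1}=I_d$. In (D), $u_i\in\mathbb C^d$ for $-1\le i\le N+1$, $\Delta u_i=u_{i+1}-u_i$, and $\nabla(\hat P_{i+1}\Delta u_i)=\hat P_{i+1}\Delta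 u_i-\hat P_i\Delta u_{i-1}$. *)

(* Defs.v *)
From HB Require Import structures.
From mathcomp Require Import all_boot all_order all_algebra.
From mathcomp Require Import all_classical all_reals all_analysis.
From mathcomp Require Export complex.
Import Order.TTheory GRing.Theory Num.Theory.
Import numFieldNormedType.Exports.

Set Implicit Arguments.
Unset Strict Implicit.
Unset Printing Implicit Defensive.

Local Open Scope classical_set_scope.
Local Open Scope ring_scope.
Local Open Scope sesquilinear_scope.

(* Measure, integration and differentiation are only available for real-valued
   functions, so the notions below for functions from R to complex matrices
   are the real ones imposed on the real and imaginary part of each entry. *)

Definition entrywise (R : realType) m n (p : (R -> R) -> Prop)
    (F : R -> 'M[R[i]]_(m, n)) : Prop :=
  forall i j, p (fun t => complex.Re (F t i j)) /\
              p (fun t => complex.Im (F t i j)).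

Definition mx_integrable (R : realType) m n (D : set R)
    (F : R -> 'M[R[i]]_(m, n)) : Prop :=
  entrywise (fun f => (@lebesgue_measure R).-integrable D (EFin \o f)) F.

Definition mx_integral (R : realType) m n (D : set R)
    (F : R -> 'M[R[i]]_(m, n)) : 'M[R[i]]_(m, n) :=
  \matrix_(i, j)
    Complex (\int[lebesgue_measure]_(t in D) complex.Re (F t i j))
            (\int[lebesgue_measure]_(t in D) complex.Im (F t i j)).

Definition abs_cont (R : realType) (a b : R) (f : R -> R) : Prop :=
  forall e : R, 0 < e -> exists2 dl : R, 0 < dl &
    forall (n : nat) (s t : 'I_n -> R),
      (forall k, a <= s k /\ s k <= t k /\ t k <= b) ->
      trivIset setT (fun k => `]s k, t k[%classic) ->
      \sum_(k < n) (t k - s k) < dl ->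
      \sum_(k < n) `|f (t k) - f (s k)| < e.

Definition mx_is_derive (R : realType) m n (F : R -> 'M[R[i]]_(m, n)) (t : R)
    (L : 'M[R[i]]_(m, n)) : Prop :=
  forall i j,
    is_derive t 1 (fun s => complex.Re (F s i j)) (complex.Re (L i j)) /\
    is_derive t 1 (fun s => complex.Im (F s i j)) (complex.Im (L i j)).

(* The order of R[i] makes 0 < z say that z is real and positive. *)
Definition posdefmx (R : realType) d (M : 'M[R[i]]_d) : Prop :=
  M \is hermsymmx /\
  forall x : 'cV[R[i]]_d, x != 0 -> 0 < (x ^t* *m M *m x) 0 0.

(* The coefficients are L^1 functions: properties are imposed almost everywhere.
   Pinv stands for the coefficient P^{-1}: it may be singular, so that P
   itself need not exist as a matrix-valued function. *)
Record sl_equation (R : realType) d (a b : R)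
    (Pinv Q W : R -> 'M[R[i]]_d) : Prop := SlEquation {
  sl_Pinv_integrable : mx_integrable `]a, b[ Pinv;
  sl_Q_integrable : mx_integrable `]a, b[ Q;
  sl_W_integrable : mx_integrable `]a, b[ W;
  sl_hermitian : \forall t \ae (@lebesgue_measure R), a < t < b ->
    [/\ Pinv t \is hermsymmx, Q t \is hermsymmx & W t \is hermsymmx]
}.

(* The partition is a = aa 0 < bb 0 < aa 1 < ... < aa N < bb N = b; the
   values of aa and bb beyond N are irrelevant. *)
Record atkinson_partition (R : realType) d (N : nat) (a b : R)
    (Pinv Q W : R -> 'M[R[i]]_d) (aa bb : nat -> R) : Prop :=
  AtkinsonPartition {
  atk_left : aa 0%N = a;
  atk_right : bb N = b;
  atk_lt_ab : forall i, (i <= N)%N -> aa i < bb i;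
  atk_lt_ba : forall j, (1 <= j <= N)%N -> bb j.-1 < aa j;
  atk_Pinv0 : forall i, (i <= N)%N ->
    \forall t \ae (@lebesgue_measure R), aa i <= t <= bb i -> Pinv t = 0;
  atk_posdef : forall i, (i <= N)%N -> posdefmx (mx_integral `[aa i, bb i] W);
  atk_QW0 : forall j, (1 <= j <= N)%N ->
    \forall t \ae (@lebesgue_measure R), bb j.-1 <= t <= aa j ->
      Q t = 0 /\ W t = 0;
  atk_unit : forall j, (1 <= j <= N)%N ->
    mx_integral `[bb j.-1, aa j] Pinv \in unitmx
}.

(* Outside 1 <= j <= N the convention is P_0 = P_{N+1} = 1. *)
Definition atkP (R : realType) d (N : nat) (Pinv : R -> 'M[R[i]]_d)
    (aa bb : nat -> R) (j : nat) : 'M[R[i]]_d :=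
  if (1 <= j <= N)%N then invmx (mx_integral `[bb j.-1, aa j] Pinv) else 1%:M.

Definition atkM (R : realType) d (F : R -> 'M[R[i]]_d)
    (aa bb : nat -> R) (i : nat) : 'M[R[i]]_d :=
  mx_integral `[aa i, bb i] F.

Definition self_adjoint_bc (R : realType) n (A B : 'M[R[i]]_n) : Prop :=
  \rank (row_mx A B) = n /\ A *m B ^t* = B *m A ^t*.

Definition bc (R : realType) d (A B : 'M[R[i]]_(d + d))
    (x0 x1 y0 y1 : 'cV[R[i]]_d) : Prop :=
  A *m col_mx (- x0) x1 + B *m col_mx y0 y1 = 0.

(* Sequences {u_i}, -1 <= i <= N+1, are functions on int whose values outside
   that range are irrelevant. *)
Definition Delta (R : realType) d (U : int -> 'cV[R[i]]_d) (i : int) :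
  'cV[R[i]]_d := U (i + 1) - U i.

Definition discrete_equation (R : realType) d (N : nat)
    (P Q W : nat -> 'M[R[i]]_d) (lambda : R[i]) (U : int -> 'cV[R[i]]_d) :
    Prop :=
  forall i : nat, (i <= N)%N ->
    - (P i.+1 *m Delta U i%:Z - P i *m Delta U (i%:Z - 1)) + Q i *m U i%:Z
    = lambda *: (W i *m U i%:Z).

Definition discrete_bc (R : realType) d (N : nat) (A B : 'M[R[i]]_(d + d))
    (U : int -> 'cV[R[i]]_d) : Prop :=
  bc A B (U 0) (U N%:Z) (Delta U (- 1)) (Delta U N%:Z).

Definition standard_discrete_bc (R : realType) d (N : nat)
    (A B : 'M[R[i]]_(d + d)) (U : int -> 'cV[R[i]]_d) : Prop :=
  bc A B (U (- 1)) (U N%:Z) (Delta U (- 1)) (Delta U N%:Z).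

(* A B are the matrices of the boundary condition in standard form. *)
Record self_adjoint_discrete_slp (R : realType) d (N : nat)
    (P Q W : nat -> 'M[R[i]]_d) (A B : 'M[R[i]]_(d + d)) : Prop :=
  SelfAdjointDiscreteSlp {
  dslp_P : forall j, (j <= N.+1)%N -> P j \is hermsymmx /\ P j \in unitmx;
  dslp_Q : forall i, (i <= N)%N -> Q i \is hermsymmx;
  dslp_W : forall i, (i <= N)%N -> posdefmx (W i);
  dslp_bc : self_adjoint_bc A B
}.

Definition discrete_problem (R : realType) d (N : nat)
    (P Q W : nat -> 'M[R[i]]_d) (A B : 'M[R[i]]_(d + d)) (lambda : R[i])
    (U : int -> 'cV[R[i]]_d) : Prop :=
  discrete_equation N P Q W lambda U /\ discrete_bc N A B U.

(* (u, v) = (y, P y') is a Caratheodory solution of the first-order system. *)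
Record sl_solution (R : realType) d (a b : R) (Pinv Q W : R -> 'M[R[i]]_d)
    (lambda : R[i]) (u v : R -> 'cV[R[i]]_d) : Prop := SlSolution {
  sol_u_ac : entrywise (abs_cont a b) u;
  sol_v_ac : entrywise (abs_cont a b) v;
  sol_u_eq : \forall t \ae (@lebesgue_measure R), a < t < b ->
    mx_is_derive u t (Pinv t *m v t);
  sol_v_eq : \forall t \ae (@lebesgue_measure R), a < t < b ->
    mx_is_derive v t ((Q t - lambda *: W t) *m u t)
}.

Definition continuous_problem (R : realType) d (a b : R)
    (Pinv Q W : R -> 'M[R[i]]_d) (A B : 'M[R[i]]_(d + d)) (lambda : R[i])
    (u v : R -> 'cV[R[i]]_d) : Prop :=
  sl_solution a b Pinv Q W lambda u v /\ bc A B (u a) (u b) (v a) (v b).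

Definition discretizes (R : realType) d (N : nat) (a b : R) (aa bb : nat -> R)
    (u v : R -> 'cV[R[i]]_d) (U : int -> 'cV[R[i]]_d) : Prop :=
  [/\ forall i : nat, (i <= N)%N ->
        forall t, aa i <= t <= bb i -> u t = U i%:Z,
      U (- 1) = U 0 - v a
    & U N.+1%:Z = U N%:Z + v b].

(* Main.v *)
Require Import Defs.
From HB Require Import structures.
From mathcomp Require Import all_boot all_order all_algebra.
From mathcomp Require Import all_classical all_reals all_analysis.
From mathcomp Require Import measurable_realfun.
From mathcomp Require Import complex.
From mathcomp Require Import lra ring.
Import Order.TTheory GRing.Theory Num.Theory.
Import numFieldNormedType.Exports.

Local Open Scope ring_scope.

Set Implicit Arguments.
Unset Strict Implicit.
Unset Printing Implicit Defensive.

(** Both problems carry the same information about the values of u on the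
    blocks [aa i, bb i] and of the flux v = P y' on the gaps between them.
    On a block P^-1 vanishes, so u is constant, equal to u_i say, and v grows
    by (Q_i - lambda W_i) u_i. On the gap before block j both Q and W vanish,
    so v is constant and u grows by (integral of P^-1) v, which says that
    v = P_j (u_j - u_(j-1)) there. With this value of v on both sides of a
    block, the growth of v over the block is the difference equation; the
    conventions P_0 = P_(N+1) = 1 and the definition of the two ghost values
    u_(-1) and u_(N+1) make it hold at the two ends as well, and turn one
    boundary condition into the other ([discretizes_equation],
    [discretizes_bc]).

    Conversely a solution of the difference equation prescribes u on blocks
    and v on gaps. Inserting these values in the right-hand sides of the
    system and integrating from a gives two functions that are absolutely
    continuous and have the prescribed derivatives almost everywhere. An
    induction along the partition, in which the difference equation gives the
    step over a block, shows that they take the prescribed values, and hence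
    solve the system ([seq_sl_solution], [seq_discretizes]).

    The analysis behind this is the fundamental theorem of calculus for
    absolutely continuous functions, [abs_cont_FTC]. One half of it is the
    absolute continuity of primitives and Lebesgue differentiation; the other
    half, [abs_cont_derive0], is that an absolutely continuous function whose
    derivative vanishes almost everywhere is constant.

    That the discrete problem is self-adjoint is mostly linear algebra.
    Writing the boundary condition with u_(-1) in place of u_0 replaces B by
    B - (A_1, 0), which preserves the rank of (A, B) and subtracts the
    Hermitian matrix A_1 A_1^* from both sides of A B^* = B A^*
    ([self_adjoint_bc_standard]); and integrals of Hermitian matrices, and
    their inverses, are Hermitian. *)

(** * Absolutely continuous functions and Lebesgue primitives *)

Section RealPrimitives.
Local Open Scope classical_set_scope.
Context {R : realType}.
Notation mu := (@lebesgue_measure R).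
(* The sigma-algebra on which the Lebesgue measure is built; stating
   measurability with it matches the lemmas on integrals syntactically. *)
Notation borel := ((R.-ocitv.-measurable).-sigma.-measurable).
Implicit Types (f g h : R -> R) (a b x : R).

Lemma ae_imply (p q : R -> Prop) : (forall x, p x -> q x) ->
  (\forall x \ae mu, p x) -> \forall x \ae mu, q x.
Proof. by apply: filterS; exact: (ae_filter_ringOfSetsType mu). Qed.

Lemma ae_imply2 (p q r : R -> Prop) : (forall x, p x -> q x -> r x) ->
  (\forall x \ae mu, p x) -> (\forall x \ae mu, q x) -> \forall x \ae mu, r x.
Proof. by apply: filterS2; exact: (ae_filter_ringOfSetsType mu). Qed.

Lemma ae_countable (I : countType) (p : I -> R -> Prop) :
  (forall i, \forall x \ae mu, p i x) -> \forall x \ae mu, forall i, p i x.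
Proof.
move=> pae.
have : \forall x \ae mu, forall n, if unpickle n is Some i then p i x else True.
  apply: ae_foralln => n; case: (unpickle n) => [i|]; first exact: pae.
  exact: aeW.
by apply: ae_imply => x px i; have := px (pickle i); rewrite pickleK.
Qed.

Lemma integrable_closed_itv a b f :
  mu.-integrable `]a, b[ (EFin \o f) -> mu.-integrable `[a, b] (EFin \o f).
Proof.
move=> /integrableP[mf foo].
have /measurable_EFinP mf' : measurable_fun `[a, b] f.
  by apply: (@measurable_fun_itv_cc _ a b false true); exact/measurable_EFinP.
apply/integrableP; split => //.
rewrite -integral_itv_bndo_bndc; last first.
  apply: measurableT_comp => //; apply: measurable_funS mf' => //.
  by apply: subset_itvl; rewrite bnd_simp.
by rewrite -integral_itv_obnd_cbnd//; exact: measurableT_comp.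
Qed.

Lemma integrable_subitv a b s t f : a <= s -> t <= b ->
  mu.-integrable `[a, b] (EFin \o f) -> mu.-integrable `[s, t] (EFin \o f).
Proof.
move=> as_ tb; apply: integrableS => // x; rewrite /= !in_itv/= => /andP[sx xt].
by rewrite (le_trans as_ sx) (le_trans xt tb).
Qed.

Lemma Rintegral_itv_sub a b s t f : a <= s -> s <= t -> t <= b ->
  mu.-integrable `[a, b] (EFin \o f) ->
  \int[mu]_(x in `[a, t]) f x - \int[mu]_(x in `[a, s]) f x =
  \int[mu]_(x in `[s, t]) f x.
Proof.
move=> as_ st tb itf.
rewrite Rintegral_itvB ?bnd_simp//; last exact: integrable_subitv itf.
rewrite Rintegral_itv_obnd_cbnd//.
apply: integrableS itf => // x; rewrite /= !in_itv/= => /andP[sx xt].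
by rewrite (le_trans as_ (ltW sx)) (le_trans xt tb).
Qed.

Lemma abs_contB a b f g :
  abs_cont a b f -> abs_cont a b g -> abs_cont a b (fun x => f x - g x).
Proof.
move=> cf cg e e0.
have [d1 d10 h1] := cf (e / 2) (divr_gt0 e0 (ltr0n _ 2)).
have [d2 d20 h2] := cg (e / 2) (divr_gt0 e0 (ltr0n _ 2)).
exists (Num.min d1 d2); first by rewrite lt_min d10.
move=> n s t st tst; rewrite lt_min => /andP[lt1 lt2].
rewrite (splitr e).
apply: le_lt_trans (ltrD (h1 n s t st tst lt1) (h2 n s t st tst lt2)).
rewrite -big_split/=; apply: ler_sum => k _.
rewrite (_ : _ - _ = (f (t k) - f (s k)) - (g (t k) - g (s k))); last by ring.
exact: ler_normB.
Qed.

Lemma abs_cont_addl c a b f : abs_cont a b f -> abs_cont a b (fun x => c + f x).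
Proof.
move=> cf e /cf[d d0 h]; exists d => // n s t st tst /(h n s t st tst).
by under [X in _ -> X < _]eq_bigr do rewrite [c + f (t _)]addrC addrKA.
Qed.

Lemma abs_cont_subitv a b s t f : a <= s -> t <= b ->
  abs_cont a b f -> abs_cont s t f.
Proof.
move=> as_ tb cf e /cf[d d0 h]; exists d => // n s' t' st; apply: h => k.
by have [h1 [h2 h3]] := st k; rewrite (le_trans as_ h1) h2 (le_trans h3 tb).
Qed.

(** The oscillations add up to at most the integral of the modulus of the
    integrand over a set of small measure, so this is the absolute continuity
    of the Lebesgue integral. *)
Lemma abs_cont_primitive a b f : mu.-integrable `[a, b] (EFin \o f) ->
  abs_cont a b (fun x => \int[mu]_(t in `[a, x]) f t).
Proof.
move=> itf e e0.
have itg : mu.-integrable setT (EFin \o (f \_ `[a, b])).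
  by move: itf; rewrite integrable_mkcond//= (restrict_EFin f).
have [d [d0 dP]] := integral_normr_continuous itg e0.
exists d => // n s t st tst std.
pose F k := `]s k, t k[%classic.
have mF k : borel (F k) by exact: measurable_itv.
have muF k : mu (F k) = (t k - s k)%:E.
  rewrite /F lebesgue_measure_itv/= lte_fin.
  have [_ [+ _]] := st k; rewrite le_eqVlt => /predU1P[->|->]; last by [].
  by rewrite ltxx subrr.
pose D := \big[setU/set0]_(k < n) F k.
have mD : borel D by apply: bigsetU_measurable => k _.
have muD : (mu D < d%:E)%E.
  rewrite /D measure_bigsetU_ord// -[ltRHS]/(d%:E) (eq_bigr (fun k => (t k - s k)%:E)).
    by rewrite sumEFin lte_fin.
  by move=> k _; exact: muF.
apply: le_lt_trans (dP D mD muD).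
have itN A : measurable A ->
    mu.-integrable A (EFin \o (fun x => `|(f \_ `[a, b]) x|)).
  by move=> mA; apply: integrable_norm => //; exact: integrableS itg.
rewrite [leRHS]/Rintegral /D ge0_integral_bigsetU//=; first last.
- by have /integrableP[] := itN _ mD.
- exact: sub_trivIset tst.
- exact: index_enum_uniq.
have -> : (\sum_(i < n) \int[mu]_(x in F i) (`|(f \_ `[a, b]) x|)%:E =
    \sum_(i < n) (\int[mu]_(x in F i) `|(f \_ `[a, b]) x|)%:E)%E.
  apply: eq_bigr => k _; rewrite /Rintegral fineK//.
  by apply: integrable_fin_num => //; exact: itN.
rewrite sumEFin/=; apply: ler_sum => k _.
have [ask [stk tkb]] := st k.
rewrite (Rintegral_itv_sub ask stk tkb itf).
have it1 : mu.-integrable `[s k, t k] (EFin \o f) by exact: integrable_subitv itf.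
have it2 : mu.-integrable (F k) (EFin \o f).
  apply: integrableS it1 => // x; rewrite /= !in_itv/= => /andP[sx xt].
  by rewrite !ltW.
rewrite -Rintegral_itv_obnd_cbnd//; last first.
  by apply: integrableS it1 => //; apply: subset_itvr; rewrite bnd_simp.
rewrite -Rintegral_itv_bndo_bndc//.
apply: (le_trans (le_normr_Rintegral (mF k) it2)).
rewrite le_eqVlt; apply/orP; left; apply/eqP; apply: eq_Rintegral => x.
rewrite inE /F/= in_itv/= => /andP[sx xt]; rewrite patchE mem_set//= in_itv/=.
by rewrite (le_trans ask (ltW sx)) (le_trans (ltW xt) tkb).
Qed.

(** The differentiation theorem for primitives, applied to the extension of f by
    zero outside [a, b]: its primitive is that of f up to b. *)
Lemma is_derive_primitive a b f : mu.-integrable `[a, b] (EFin \o f) ->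
  \forall x \ae mu, a < x < b ->
    is_derive x 1 (fun y => \int[mu]_(t in `[a, y]) f t) (f x).
Proof.
move=> itf.
have itg : mu.-integrable setT (EFin \o (f \_ `[a, b])).
  by move: itf; rewrite integrable_mkcond//= (restrict_EFin f).
have locg := integrable_locally (measurable_itv _) itf.
have itg' y : mu.-integrable [set` Interval (BLeft a) (BRight y)]
    (EFin \o (f \_ `[a, b])) by exact: integrableS itg.
have := FTC1 itg' locg; apply: ae_imply => x /= Hx /andP[ax xb].
have [|dF Fx] := Hx; first by rewrite lte_fin.
move: Fx; rewrite derive1E patchE mem_set; last by rewrite /= in_itv/= !ltW.
move=> Fx.
have : is_derive x 1
  (fun y => \int[mu]_(t in `[a, y]) (f \_ `[a, b]) t) (f x) by exact: DeriveDef.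
apply: near_eq_is_derive.
near=> y; apply: eq_Rintegral => z; rewrite inE/= in_itv/= => /andP[az zy].
rewrite patchE mem_set//= in_itv/= az (le_trans zy)//.
by apply: ltW; near: y; exact: lt_nbhsl.
Unshelve. all: by end_near. Qed.

Lemma is_derive0_le h x (e : R) : 0 < e -> is_derive x 1 h 0 ->
  exists2 r : R, 0 < r & forall y, `|y - x| < r -> `|h y - h x| <= e * `|y - x|.
Proof.
move=> e0 /is_derive1_caratheodory[g [hg cg gx]].
have /cvgr0_norm_le/(_ _ e0)[r /= r0 rP] : g z @[z --> x] --> 0 by rewrite -gx.
exists r => // y yx; rewrite hg normrM ler_wpM2r//.
by apply: rP; rewrite /= distrC.
Qed.

(** The invariant of the real induction below: outside the chain h moves by at
    most e per unit length, and inside the chain, which stays in U, its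
    oscillation is left to absolute continuity. *)
Definition slope_chain (U : set R) (e : R) h a x (n : nat) (s t : nat -> R) :=
  [/\ forall k, (k < n)%N ->
        [/\ a <= s k, s k <= t k, t k <= x & `]s k, t k[ `<=` U],
      forall j k, (j < k)%N -> (k < n)%N -> t j <= s k
    & `|h x - h a| <= e * (x - a) + \sum_(k < n) `|h (t k) - h (s k)|].

Lemma slope_chain_extend U e h a x y n s t : x <= y ->
  `|h y - h x| <= e * (y - x) ->
  slope_chain U e h a x n s t -> slope_chain U e h a y n s t.
Proof.
move=> xy hxy [h1 h2 h3]; split => //.
  by move=> k /h1[? ? tx ?]; split => //; exact: le_trans xy.
rewrite (_ : h y - h a = (h y - h x) + (h x - h a)); last by ring.
apply: (le_trans (ler_normD _ _)); apply: (le_trans (lerD hxy h3)).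
by rewrite le_eqVlt; apply/orP; left; apply/eqP; ring.
Qed.

Lemma slope_chain_rcons U e h a x y n s t : 0 <= e -> a <= x -> x <= y ->
  `]x, y[ `<=` U ->
  slope_chain U e h a x n s t ->
  slope_chain U e h a y n.+1 (fun k => if k == n then x else s k)
                             (fun k => if k == n then y else t k).
Proof.
move=> e0 ax xy xyU [h1 h2 h3]; split.
- move=> k; rewrite ltnS; have [->//|kn] := eqVneq k n.
  by rewrite leq_eqVlt (negbTE kn) => /h1[? ? tx ?]; split => //; exact: le_trans xy.
- move=> j k jk; rewrite ltnS => kn.
  have jn : (j < n)%N by exact: leq_trans kn.
  rewrite (ltn_eqF jn); have [_|kn'] := eqVneq k n; first by have [] := h1 _ jn.
  by apply: h2 => //; rewrite ltn_neqAle kn'.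
rewrite big_ord_recr/= eqxx.
rewrite (eq_bigr (fun k : 'I_n => `|h (t k) - h (s k)|)); last first.
  by move=> k _; rewrite (ltn_eqF (ltn_ord k)).
rewrite (_ : h y - h a = (h x - h a) + (h y - h x)); last by ring.
apply: (le_trans (ler_normD _ _)); rewrite addrA lerD2r.
by apply: (le_trans h3); rewrite lerD2r ler_wpM2l// lerB.
Qed.

(** The intervals of a chain are disjoint, so their lengths add up to at most
    the measure of U. *)
Lemma slope_chain_length U e h a x n s t : open U ->
  slope_chain U e h a x n s t ->
  trivIset setT (fun k : 'I_n => `]s k, t k[%classic) /\
  ((\sum_(k < n) (t k - s k))%:E <= mu U)%E.
Proof.
move=> oU [h1 h2 _].
have tI : trivIset setT (fun k : 'I_n => `]s k, t k[%classic).
  apply/trivIsetP => j k _ _ jk; wlog jk' : j k jk / (j < k)%N.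
    move=> hw; have [|kj] := ltnP j k; first exact: hw.
    rewrite setIC; apply: hw; rewrite 1?eq_sym//.
    by rewrite ltn_neqAle kj andbT eq_sym.
  rewrite -subset0 => z [] /=; rewrite !in_itv/= => /andP[_ zj] /andP[kz _].
  have := lt_le_trans zj (h2 j k jk' (ltn_ord k)).
  by rewrite ltNge (ltW kz).
split => //.
pose F (k : 'I_n) := `]s k, t k[%classic.
have mF k : borel (F k) by exact: measurable_itv.
have muF k : mu (F k) = (t k - s k)%:E.
  rewrite /F lebesgue_measure_itv/= lte_fin.
  have [_ + _ _] := h1 k (ltn_ord k).
  rewrite le_eqVlt => /predU1P[->|->]; last by [].
  by rewrite ltxx subrr.
rewrite -sumEFin (eq_bigr (fun k => mu (F k))); last by move=> k _; rewrite muF.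
rewrite -measure_bigsetU_ord//; apply: le_measure; rewrite ?inE//.
- exact: bigsetU_measurable.
- exact: open_measurable.
- apply: (big_ind (fun A => A `<=` U)) => [|A B AU BU|k _]; first exact: sub0set.
    by rewrite subUset.
  by have [] := h1 _ (ltn_ord k).
Qed.

(** A real induction covers [a, b] by a chain whose intervals lie in an open
    set U of small measure containing the exceptional null set: outside U the
    function has slope at most e because its derivative vanishes, and inside U
    absolute continuity bounds the total variation along the chain. *)
Lemma abs_cont_derive0 a b h : a <= b -> abs_cont a b h ->
  (\forall x \ae mu, a < x < b -> is_derive x 1 h 0) -> h b = h a.
Proof.
move=> ab ach [N [mN muN NP]].
suff H (e : R) : 0 < e -> `|h b - h a| <= e * (b - a + 1).
  apply/eqP; rewrite -subr_eq0 -normr_le0; apply/ler_addgt0Pr => e e0.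
  rewrite add0r; have ba1 : 0 < b - a + 1 by rewrite ltr_wpDl// subr_ge0.
  by have := H _ (divr_gt0 e0 ba1); rewrite divfK// gt_eqF.
move=> e0; have [dl dl0 dlP] := ach e e0.
(* Nothing is known about the derivative at a and b, so they join the
   exceptional set. *)
pose N' := N `|` [set a; b].
have mN' : measurable N' by apply: measurableU => //; exact: measurableU.
have muN' : mu N' = 0%E.
  apply/eqP; rewrite eq_le measure_ge0 andbT.
  apply: (le_trans (measureU2 mu _ _)) => //; first exact: measurableU.
  rewrite [X in (X + _)%E]muN add0e; apply: (le_trans (measureU2 mu _ _)) => //.
  rewrite [X in (X + _)%E]lebesgue_measure_set1.
  by rewrite [X in (_ + X)%E]lebesgue_measure_set1 adde0.
have [|U [oU NU muU]] := @lebesgue_regularity_outer R N' dl mN' _ dl0.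
  by apply: (@le_lt_trans _ _ 0%E); rewrite ?ltry// -[X in (_ <= X)%E]muN'.
have {}muU : (mu U < dl%:E)%E.
  apply: le_lt_trans muU; rewrite -[leLHS](_ : mu (U `\` N' `|` N') = _).
    apply: (le_trans (measureU2 mu _ _)) => //; last first.
      by rewrite [X in (_ + X)%E]muN' adde0.
    by apply: measurableD => //; exact: open_measurable.
  by congr (mu _); rewrite setUC setDUK.
pose P x := a <= x <= b /\ exists n s t, slope_chain U e h a x n s t.
have Pa : P a.
  split; first by rewrite lexx.
  exists 0%N, (fun=> a), (fun=> a); split => //.
  by rewrite big_ord0 !subrr mulr0 addr0 normr0.
(* One step of the induction: near z a chain can be carried across z, by
   adding an interval inside U if z is exceptional and for free otherwise. *)
have step z : a <= z <= b -> exists2 r : R, 0 < r &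
    forall x y, P x -> x <= z <= y -> y <= b -> z - r < x -> y < z + r -> P y.
  move=> zab; have [zN|zN] := pselect (N' z).
    have /= [r /= r0 rU] : nbhs z U.
      by apply: open_nbhs_nbhs; split => //; exact: NU.
    exists r => // x y [/andP[ax xb] [n [s [t st]]]] /andP[xz zy] yb zx yz.
    have xy := le_trans xz zy.
    split; first by rewrite (le_trans ax xy).
    exists n.+1; do 2!eexists; apply: slope_chain_rcons st => //; first exact: ltW.
    move=> w; rewrite /= in_itv/= => /andP[xw wy]; apply: rU => /=.
    by rewrite ltr_norml; apply/andP; split; lra.
  have dz : is_derive z 1 h 0.
    apply: contra_notP zN => dz.
    have [->|za] := eqVneq z a; first by right; left.
    have [->|zb] := eqVneq z b; first by right; right.
    left; apply: NP => /= /(_ _)/dz; apply.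
    move: zab; rewrite le_eqVlt eq_sym (negbTE za)/= => /andP[->].
    by rewrite le_eqVlt (negbTE zb).
  have [r r0 rP] := is_derive0_le e0 dz.
  exists r => // x y [/andP[ax xb] [n [s [t st]]]] /andP[xz zy] yb zx yz.
  have xy := le_trans xz zy.
  split; first by rewrite (le_trans ax xy).
  exists n, s, t; apply: slope_chain_extend st => //.
  rewrite (_ : h y - h x = (h y - h z) - (h x - h z)); last by ring.
  apply: (le_trans (ler_normB _ _)).
  have hy : `|h y - h z| <= e * (y - z).
    rewrite -[X in _ * X]ger0_norm ?subr_ge0//; apply: rP.
    by rewrite ger0_norm ?subr_ge0//; lra.
  have hx : `|h x - h z| <= e * (z - x).
    rewrite -[X in _ * X]ger0_norm ?subr_ge0// [X in _ * X]distrC; apply: rP.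
    by rewrite distrC ger0_norm ?subr_ge0//; lra.
  by apply: (le_trans (lerD hy hx)); rewrite -mulrDr ler_wpM2l ?(ltW e0)//; lra.
pose S := [set x | P x]; pose z := sup S.
have supS : has_sup S.
  by split; [exists a|exists b => x [/andP[]]].
have zab : a <= z <= b.
  apply/andP; split; first by apply: ub_le_sup => //; case: supS.
  by apply: ge_sup; [exists a|move=> x [/andP[]]].
have [r r0 rP] := step z zab.
have [x Px zx] := sup_adherent r0 supS.
have xz : x <= z by apply: ub_le_sup => //; case: supS.
have [/andP[az] zb] := zab.
have Pb : P b.
  have [bz|zb'] := leP b (z + r / 2).
    have [zrb|bzr] := ltP b (z + r); last lra.
    by apply: (rP x) => //; rewrite xz.
  have : P (z + r / 2) by apply: (rP x) => //; [rewrite xz|exact: ltW|]; lra.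
  by move=> /(ub_le_sup supS.2); rewrite -/z; lra.
(* The chain ends at b: its total oscillation is below e since its total
   length is below dl. *)
have [_ [n [s [t st]]]] := Pb.
have [tI lU] := slope_chain_length oU st.
have [h1 _ h3] := st.
apply: (le_trans h3); rewrite [leRHS]mulrDr mulr1 lerD2l; apply: ltW.
apply: dlP => //; last by rewrite -lte_fin; exact: le_lt_trans muU.
by move=> k; have [] := h1 _ (ltn_ord k).
Qed.

(** The fundamental theorem of calculus for absolutely continuous functions:
    such a function and the primitive of its derivative differ by a function
    with zero derivative almost everywhere. *)
Lemma abs_cont_FTC a b s t f g : abs_cont a b f ->
  (\forall x \ae mu, a < x < b -> is_derive x 1 f (g x)) ->
  mu.-integrable `[a, b] (EFin \o g) -> a <= s -> s <= t -> t <= b ->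
  f t - f s = \int[mu]_(x in `[s, t]) g x.
Proof.
move=> cf df ig as_ st tb.
rewrite -(Rintegral_itv_sub as_ st tb ig).
(* An opaque name keeps unification from unfolding the primitive. *)
have [h hE] : exists h, h = fun x => f x - \int[mu]_(y in `[a, x]) g y by eexists.
suff : h t = h s by rewrite hE => /eqP; rewrite subr_eq => /eqP ->; ring.
apply: abs_cont_derive0 => //.
  apply: (abs_cont_subitv as_ tb); rewrite hE.
  by apply: abs_contB => //; exact: abs_cont_primitive.
apply: ae_imply2 df (is_derive_primitive ig) => x H1 H2 /andP[sx xt].
have xab : a < x < b by rewrite (le_lt_trans as_ sx) (lt_le_trans xt tb).
rewrite hE.
have := is_deriveB (H1 xab) (H2 xab); rewrite subrr; exact.
Qed.
End RealPrimitives.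

(** * Integrals of complex-valued functions *)

Section ComplexIntegral.
Local Open Scope classical_set_scope.
Context {R : realType}.
Notation mu := (@lebesgue_measure R).
Notation borel := ((R.-ocitv.-measurable).-sigma.-measurable).
Implicit Types (D : set R) (f g : R -> R[i]) (c : R[i]).

Definition cintegrable D f :=
  mu.-integrable D (EFin \o (fun t => complex.Re (f t))) /\
  mu.-integrable D (EFin \o (fun t => complex.Im (f t))).

Definition cintegral D f :=
  Complex (\int[mu]_(t in D) complex.Re (f t)) (\int[mu]_(t in D) complex.Im (f t)).

(** The conjugation of a numerically closed field is the explicit one on R[i];
    this is the link between Hermitian matrices and entrywise integrals. *)
Lemma conjC_Complex (x y : R) : Num.conj (Complex x y) = Complex x (- y).
Proof. by []. Qed.

(** The real and imaginary parts of a product by a constant, and of a sum, are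
    real combinations of this form; all complex linearity rests on it. *)
Lemma integrable_lin (x y : R) D (p q : R -> R) : borel D ->
  mu.-integrable D (EFin \o p) -> mu.-integrable D (EFin \o q) ->
  mu.-integrable D (EFin \o (fun t => x * p t + y * q t)).
Proof.
move=> mD ip iq.
have := integrableD mD (integrableZl mD x ip) (integrableZl mD y iq).
by apply: eq_integrable.
Qed.

Lemma Rintegral_lin (x y : R) D (p q : R -> R) : borel D ->
  mu.-integrable D (EFin \o p) -> mu.-integrable D (EFin \o q) ->
  \int[mu]_(t in D) (x * p t + y * q t) =
  x * \int[mu]_(t in D) p t + y * \int[mu]_(t in D) q t.
Proof.
move=> mD ip iq.
have ixp : mu.-integrable D (EFin \o (fun t => x * p t)).
  by have := integrableZl mD x ip; exact: eq_integrable.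
have iyq : mu.-integrable D (EFin \o (fun t => y * q t)).
  by have := integrableZl mD y iq; exact: eq_integrable.
by rewrite RintegralD// !RintegralZl.
Qed.

Lemma cintegrableM c D f : borel D ->
  cintegrable D f -> cintegrable D (fun t => c * f t).
Proof.
case: c => x y mD [fr fi]; split.
  have := integrable_lin x (- y) mD fr fi; apply: eq_integrable => // t _ /=.
  by case: (f t) => p q /=; rewrite mulNr.
have := integrable_lin x y mD fi fr; apply: eq_integrable => // t _ /=.
by case: (f t) => p q /=; rewrite addrC.
Qed.

Lemma cintegralM c D f : borel D ->
  cintegrable D f -> cintegral D (fun t => c * f t) = c * cintegral D f.
Proof.
case: c => x y mD [fr fi]; rewrite /cintegral.
have -> : \int[mu]_(t in D) complex.Re (Complex x y * f t) =
    \int[mu]_(t in D) (x * complex.Re (f t) + (- y) * complex.Im (f t)).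
  by apply: eq_Rintegral => t _; case: (f t) => p q /=; rewrite mulNr.
have -> : \int[mu]_(t in D) complex.Im (Complex x y * f t) =
    \int[mu]_(t in D) (x * complex.Im (f t) + y * complex.Re (f t)).
  by apply: eq_Rintegral => t _; case: (f t) => p q /=; rewrite addrC.
by rewrite !Rintegral_lin//; simpc; rewrite [_ + _ * \int[_]_(_ in _) complex.Re _]addrC.
Qed.

Lemma cintegrableD D f g : borel D ->
  cintegrable D f -> cintegrable D g -> cintegrable D (fun t => f t + g t).
Proof.
move=> mD [fr fi] [gr gi]; split.
  have := integrable_lin 1 1 mD fr gr; apply: eq_integrable => // t _ /=.
  by case: (f t) (g t) => ? ? [? ?] /=; rewrite !mul1r.
have := integrable_lin 1 1 mD fi gi; apply: eq_integrable => // t _ /=.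
by case: (f t) (g t) => ? ? [? ?] /=; rewrite !mul1r.
Qed.

Lemma cintegralD D f g : borel D ->
  cintegrable D f -> cintegrable D g ->
  cintegral D (fun t => f t + g t) = cintegral D f + cintegral D g.
Proof.
move=> mD [fr fi] [gr gi]; rewrite /cintegral; simpc.
rewrite -!RintegralD//; congr Complex; apply: eq_Rintegral => t _.
  by case: (f t) (g t) => ? ? [? ?].
by case: (f t) (g t) => ? ? [? ?].
Qed.

Lemma cintegrable0 D : borel D ->
  cintegrable D (fun=> 0).
Proof. by move=> mD; split; exact: integrable0. Qed.

Lemma cintegral0 D : cintegral D (fun=> 0) = 0.
Proof. by rewrite /cintegral /= /Rintegral integral0. Qed.

Lemma cintegrable_sum D (I : Type) (r : seq I) (F : I -> R -> R[i]) :
  borel D ->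
  (forall k, cintegrable D (F k)) -> cintegrable D (fun t => \sum_(k <- r) F k t).
Proof.
move=> mD iF; elim: r => [|k r IH].
  by under eq_fun do rewrite big_nil; exact: cintegrable0.
by under eq_fun do rewrite big_cons; exact: cintegrableD.
Qed.

Lemma cintegral_sum D (I : Type) (r : seq I) (F : I -> R -> R[i]) :
  borel D ->
  (forall k, cintegrable D (F k)) ->
  cintegral D (fun t => \sum_(k <- r) F k t) = \sum_(k <- r) cintegral D (F k).
Proof.
move=> mD iF; elim: r => [|k r IH].
  by under eq_fun do rewrite big_nil; rewrite big_nil cintegral0.
under eq_fun do rewrite big_cons.
by rewrite cintegralD// ?IH ?big_cons//; exact: cintegrable_sum.
Qed.

Lemma cintegral_ae D f g : borel D ->
  cintegrable D f -> cintegrable D g -> (\forall t \ae mu, D t -> f t = g t) ->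
  cintegral D f = cintegral D g.
Proof.
move=> mD [/integrableP[fr _] /integrableP[fi _]].
move=> [/integrableP[gr _] /integrableP[gi _]] fg.
rewrite /cintegral /Rintegral; congr (Complex (fine _) (fine _)).
  apply: ae_eq_integral => //.
  by apply: ae_imply fg => t /[apply] /= ->.
apply: ae_eq_integral => //.
by apply: ae_imply fg => t /[apply] /= ->.
Qed.

Lemma cintegral_conj D f : borel D ->
  cintegrable D f -> cintegral D (fun t => (f t)^*) = (cintegral D f)^*.
Proof.
move=> mD [fr fi]; rewrite /cintegral conjC_Complex; congr Complex.
  by apply: eq_Rintegral => t _; case: (f t).
rewrite -mulN1r -RintegralZl//.
by apply: eq_Rintegral => t _; case: (f t) => p q; rewrite mulN1r.
Qed.

Lemma cintegrable_conj D f : borel D ->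
  cintegrable D f -> cintegrable D (fun t => (f t)^*).
Proof.
move=> mD [fr fi]; split.
  by apply: eq_integrable fr => // t _ /=; case: (f t).
have := integrable_lin (-1) 0 mD fi fi; apply: eq_integrable => // t _ /=.
by case: (f t) => p q /=; rewrite mulN1r mul0r addr0.
Qed.

Lemma cintegrable_if D (E : set R) (b : pred R) f :
  borel D ->
  borel E ->
  (forall t, b t <-> E t) -> cintegrable D f ->
  cintegrable D (fun t => if b t then f t else 0).
Proof.
move=> mD mE bE [fr fi].
have EI (h : R -> R) : mu.-integrable D (EFin \o h) ->
    mu.-integrable D (EFin \o (fun t => if b t then h t else 0)).
  move=> ih.
  have : mu.-integrable D ((EFin \o h) \_ E).
    by apply/integrable_restrict => //; apply: integrableS ih => //; exact: measurableI.
  apply: eq_integrable => // t _ /=; rewrite patchE /=.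
  case: ifPn => [/set_mem/bE ->//|/negP tE]; case: ifPn => // /bE Et.
  by exfalso; apply: tE; exact: mem_set.
split.
  by apply: eq_integrable (EI _ fr) => // t _ /=; case: ifP.
by apply: eq_integrable (EI _ fi) => // t _ /=; case: ifP.
Qed.

End ComplexIntegral.

(** * Integrals of complex matrices *)

Section MatrixIntegral.
Local Open Scope classical_set_scope.
Context {R : realType}.
Notation mu := (@lebesgue_measure R).
Notation borel := ((R.-ocitv.-measurable).-sigma.-measurable).
Notation C := R[i].
Implicit Types (D : set R) (a b s t : R).

Lemma mx_integrableMr m n p D (F : R -> 'M[C]_(m, n)) (A : 'M[C]_(n, p)) :
  borel D -> mx_integrable D F -> mx_integrable D (fun t => F t *m A).
Proof.
move=> mD iF i j; under eq_fun do rewrite mxE.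
under [X in _ /\ mu.-integrable D (EFin \o X)]eq_fun do rewrite mxE.
apply: cintegrable_sum => // k; under eq_fun do rewrite mulrC.
by apply: cintegrableM => //; exact: iF.
Qed.

Lemma mx_integralMr m n p D (F : R -> 'M[C]_(m, n)) (A : 'M[C]_(n, p)) :
  borel D -> mx_integrable D F ->
  mx_integral D (fun t => F t *m A) = mx_integral D F *m A.
Proof.
move=> mD iF; apply/matrixP => i j; rewrite !mxE -/(cintegral D _).
under eq_fun do rewrite mxE.
have iFk k : cintegrable D (fun t => A k j * F t i k).
  by apply: cintegrableM => //; exact: iF.
under eq_fun do under eq_bigr do rewrite mulrC.
rewrite cintegral_sum//; apply: eq_bigr => k _.
by rewrite cintegralM ?mxE 1?mulrC//; exact: iF.
Qed.

Lemma mx_integrable_subZ m n D (F G : R -> 'M[C]_(m, n)) c :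
  borel D -> mx_integrable D F -> mx_integrable D G ->
  mx_integrable D (fun t => F t - c *: G t).
Proof.
move=> mD iF iG i j; rewrite -/(cintegrable D (fun t => (F t - c *: G t) i j)).
have -> : (fun t => (F t - c *: G t) i j) = (fun t => F t i j + (- c) * G t i j).
  by apply/funext => t; rewrite !mxE mulNr.
by apply: cintegrableD => //; apply: cintegrableM.
Qed.

Lemma mx_integral_subZ m n D (F G : R -> 'M[C]_(m, n)) c :
  borel D -> mx_integrable D F -> mx_integrable D G ->
  mx_integral D (fun t => F t - c *: G t) = mx_integral D F - c *: mx_integral D G.
Proof.
move=> mD iF iG; apply/matrixP => i j; rewrite !mxE -!/(cintegral D _).
rewrite -mulNr -cintegralM// -cintegralD//; last exact: cintegrableM.
by congr (cintegral D); apply/funext => t; rewrite !mxE mulNr.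
Qed.

Lemma mx_integrable0 m n D :
  borel D -> mx_integrable D (fun=> 0 : 'M[C]_(m, n)).
Proof.
move=> mD i j; rewrite -/(cintegrable D (fun=> (0 : 'M[C]_(m, n)) i j)).
by rewrite mxE; exact: cintegrable0.
Qed.

Lemma mx_integral0 m n D : mx_integral D (fun=> 0 : 'M[C]_(m, n)) = 0.
Proof.
apply/matrixP => i j; rewrite !mxE -/(cintegral D _).
exact: cintegral0.
Qed.

Lemma mx_integral_ae m n D (F G : R -> 'M[C]_(m, n)) :
  borel D -> mx_integrable D F -> mx_integrable D G ->
  (\forall t \ae mu, D t -> F t = G t) -> mx_integral D F = mx_integral D G.
Proof.
move=> mD iF iG FG; apply/matrixP => i j; rewrite !mxE -!/(cintegral D _).
apply: cintegral_ae => //.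
by apply: ae_imply FG => t /[apply] ->.
Qed.

Lemma mx_integrable_closed_itv m n a b (F : R -> 'M[C]_(m, n)) :
  mx_integrable `]a, b[ F -> mx_integrable `[a, b] F.
Proof.
by move=> iF i j; have [? ?] := iF i j; split; exact: integrable_closed_itv.
Qed.

Lemma mx_integrable_subitv m n a b s t (F : R -> 'M[C]_(m, n)) :
  a <= s -> t <= b -> mx_integrable `[a, b] F -> mx_integrable `[s, t] F.
Proof.
move=> as_ tb iF i j; have [? ?] := iF i j.
by split; exact: (integrable_subitv as_ tb).
Qed.

Lemma mx_integral_itv_sub m n a b s t (F : R -> 'M[C]_(m, n)) :
  a <= s -> s <= t -> t <= b -> mx_integrable `[a, b] F ->
  mx_integral `[a, t] F - mx_integral `[a, s] F = mx_integral `[s, t] F.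
Proof.
move=> as_ st tb iF; apply/matrixP => i j; rewrite !mxE; simpc.
have [? ?] := iF i j.
by rewrite !(Rintegral_itv_sub as_ st tb).
Qed.

Lemma mx_integral_itv1 m n a (F : R -> 'M[C]_(m, n)) : mx_integral `[a, a] F = 0.
Proof. by apply/matrixP => i j; rewrite !mxE set_itv1 !Rintegral_set1. Qed.

(** Integration commutes with transposition and with conjugation. *)
Lemma mx_integral_hermsym n D (F : R -> 'M[C]_n) :
  borel D -> mx_integrable D F ->
  (\forall t \ae mu, D t -> F t \is hermsymmx) -> mx_integral D F \is hermsymmx.
Proof.
move=> mD iF hF; apply/is_hermitianmxP; rewrite expr0 scale1r.
apply/matrixP => i j; rewrite !mxE -!/(cintegral D _).
rewrite -cintegral_conj//.
apply: cintegral_ae => //; first exact: cintegrable_conj.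
apply: ae_imply hF => t /[apply] /is_hermitianmxP {1}->.
by rewrite expr0 scale1r !mxE.
Qed.

Lemma mx_abs_cont_subitv m n a b s t (F : R -> 'M[C]_(m, n)) :
  a <= s -> t <= b -> entrywise (abs_cont a b) F -> entrywise (abs_cont s t) F.
Proof.
move=> as_ tb cF i j; have [? ?] := cF i j.
by split; exact: (abs_cont_subitv as_ tb).
Qed.

Lemma mx_abs_cont_primitive m n a b (F : R -> 'M[C]_(m, n)) (A : 'M[C]_(m, n)) :
  mx_integrable `[a, b] F ->
  entrywise (abs_cont a b) (fun t => A + mx_integral `[a, t] F).
Proof.
move=> iF i j; have [iR iI] := iF i j; split.
  under eq_fun do rewrite !mxE raddfD /=.
  exact: (abs_cont_addl _ (abs_cont_primitive iR)).
under eq_fun do rewrite !mxE raddfD /=.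
exact: (abs_cont_addl _ (abs_cont_primitive iI)).
Qed.

Lemma mx_is_derive_primitive m n a b (F : R -> 'M[C]_(m, n)) (A : 'M[C]_(m, n)) :
  mx_integrable `[a, b] F ->
  \forall t \ae mu, a < t < b ->
    mx_is_derive (fun t => A + mx_integral `[a, t] F) t (F t).
Proof.
move=> iF.
suff : \forall t \ae mu, forall ij : 'I_m * 'I_n, a < t < b ->
    is_derive t 1 (fun s => complex.Re ((A + mx_integral `[a, s] F) ij.1 ij.2))
                  (complex.Re (F t ij.1 ij.2)) /\
    is_derive t 1 (fun s => complex.Im ((A + mx_integral `[a, s] F) ij.1 ij.2))
                  (complex.Im (F t ij.1 ij.2)).
  by apply: ae_imply => t H tab i j; exact: H (i, j) tab.
apply: ae_countable => -[i j] /=; have [iR iI] := iF i j.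
apply: ae_imply2 (is_derive_primitive iR) (is_derive_primitive iI).
move=> t HR HI tab; split.
  have := is_deriveD (is_derive_cst (complex.Re (A i j)) t 1) (HR tab).
  rewrite add0r; under eq_fun do rewrite /=.
  by under [X in _ -> is_derive _ _ X _]eq_fun do rewrite !mxE raddfD.
have := is_deriveD (is_derive_cst (complex.Im (A i j)) t 1) (HI tab).
rewrite add0r.
by under [X in _ -> is_derive _ _ X _]eq_fun do rewrite !mxE raddfD.
Qed.

(** The right-hand side F' of the system involves the unknown itself. Letting
    it be replaced almost everywhere by a G known to be integrable spares any
    integrability argument about the product of a coefficient and a solution. *)
Lemma mx_abs_cont_FTC m n a b s t (F F' G : R -> 'M[C]_(m, n)) :
  a <= s -> s <= t -> t <= b ->
  entrywise (abs_cont a b) F ->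
  (\forall x \ae mu, a < x < b -> mx_is_derive F x (F' x)) ->
  (\forall x \ae mu, s <= x <= t -> F' x = G x) ->
  mx_integrable `[s, t] G ->
  F t - F s = mx_integral `[s, t] G.
Proof.
move=> as_ st tb cF dF F'G iG; apply/matrixP => i j; rewrite !mxE.
have [cR cI] := mx_abs_cont_subitv as_ tb cF i j; have [iR iI] := iG i j.
have dG : \forall x \ae mu, s < x < t -> mx_is_derive F x (G x).
  apply: ae_imply2 dF F'G => x dF F'G /andP[sx xt].
  by rewrite -F'G ?ltW//; apply: dF; rewrite (le_lt_trans as_ sx) (lt_le_trans xt tb).
rewrite -(abs_cont_FTC cR _ iR)// -?(abs_cont_FTC cI _ iI)//; first last.
- by apply: ae_imply dG => x /[apply] /(_ i j)[].
- by apply: ae_imply dG => x /[apply] /(_ i j)[].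
by case: (F t i j) (F s i j) => ? ? [? ?]; simpc.
Qed.

Lemma mx_integrable_sum m n k D (F : 'I_k -> R -> 'M[C]_(m, n)) : borel D ->
  (forall l, mx_integrable D (F l)) ->
  mx_integrable D (fun t => \sum_(l < k) F l t).
Proof.
move=> mD iF i j; rewrite -/(cintegrable D (fun t => (\sum_l F l t) i j)).
under eq_fun do rewrite summxE.
by apply: cintegrable_sum => // l; exact: iF.
Qed.

Lemma mx_integrable_if m n D s t (F : R -> 'M[C]_(m, n)) : borel D ->
  mx_integrable D F -> mx_integrable D (fun x => if s <= x <= t then F x else 0).
Proof.
move=> mD iF i j.
rewrite -/(cintegrable D (fun x => (if s <= x <= t then F x else 0) i j)).
have -> : (fun x => (if s <= x <= t then F x else 0) i j) =
    fun x => if s <= x <= t then F x i j else 0.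
  by apply/funext => x; case: ifP => // _; rewrite mxE.
by apply: (@cintegrable_if _ D `[s, t]).
Qed.

End MatrixIntegral.

(** * Self-adjoint boundary conditions *)

Section BoundaryCondition.
Context {R : realType}.
Notation C := R[i].
Local Open Scope sesquilinear_scope.

Lemma bc_row_mx d (A1 A2 B1 B2 : 'M[C]_(d + d, d)) (x0 x1 y0 y1 : 'cV[C]_d) :
  bc (row_mx A1 A2) (row_mx B1 B2) x0 x1 y0 y1 <->
  A1 *m (- x0) + A2 *m x1 + (B1 *m y0 + B2 *m y1) = 0.
Proof. by rewrite /bc !mul_row_col. Qed.

(** As u_0 = u_(-1) + Delta u_(-1), the term - A_1 u_0 is - A_1 u_(-1) up to
    - A_1 Delta u_(-1), which B_1 absorbs. *)
Lemma standard_discrete_bcE d N (A1 A2 B1 B2 : 'M[C]_(d + d, d))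
    (U : int -> 'cV[C]_d) :
  discrete_bc N (row_mx A1 A2) (row_mx B1 B2) U <->
  standard_discrete_bc N (row_mx A1 A2) (row_mx (B1 - A1) B2) U.
Proof.
rewrite /discrete_bc /standard_discrete_bc !bc_row_mx.
have -> : U 0 = Delta U (- 1) + U (- 1) by rewrite /Delta addNr subrK.
rewrite opprD mulmxDr mulmxBl mulmxN.
set x := A1 *m Delta _ _; set y := A1 *m _; set z := A2 *m _.
set p := B1 *m _; set q := B2 *m _.
suff -> : - x + y + z + (p + q) = y + z + (p - x + q) by [].
by rewrite addrA [LHS](ACl (2*3*(4*1*5))%AC).
Qed.

(** Subtracting (A_1, 0) from B is a column operation on (A, B), and it changes
    A B^* by the Hermitian matrix A_1 A_1^*. *)
Lemma self_adjoint_bc_standard d (A1 A2 B1 B2 : 'M[C]_(d + d, d)) :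
  self_adjoint_bc (row_mx A1 A2) (row_mx B1 B2) ->
  self_adjoint_bc (row_mx A1 A2) (row_mx (B1 - A1) B2).
Proof.
move=> [rkAB sAB]; split; last first.
  have -> : row_mx (B1 - A1) B2 = row_mx B1 B2 - row_mx A1 0.
    by rewrite opp_row_mx add_row_mx oppr0 addr0.
  rewrite linearB/= raddfB/= mulmxBr mulmxBl sAB; congr (_ - _).
  rewrite !tr_row_mx !map_col_mx !mul_row_col trmx0 map_mx0 mulmx0.
  by congr (_ + _); exact/esym/mul0mx.
apply/eqP; apply: inj_row_free => v.
rewrite !mul_mx_row => /eqP; rewrite !row_mx_eq0.
move=> /andP[/andP[/eqP vA1 /eqP vA2] /andP[/eqP vB /eqP vB2]].
have rfAB : row_free (row_mx (row_mx A1 A2) (row_mx B1 B2)) by apply/eqP.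
apply/eqP; rewrite -(mulmx_free_eq0 v rfAB) !mul_mx_row.
by move: vB; rewrite mulmxBr vA1 vA2 vB2 subr0 => ->; rewrite !row_mx0.
Qed.

Lemma hermsymmx_inv d (M : 'M[C]_d) : M \is hermsymmx -> invmx M \is hermsymmx.
Proof.
move=> /is_hermitianmxP; rewrite expr0 scale1r => hM.
apply/is_hermitianmxP; rewrite expr0 scale1r.
by rewrite trmx_inv map_invmx -hM.
Qed.

End BoundaryCondition.

(** * Order properties of the partition *)

Section AtkinsonPartition.
Context {R : realType}.
Context (d N : nat) (a b : R) (Pinv Q W : R -> 'M[R[i]]_d) (aa bb : nat -> R).
Context (hatk : atkinson_partition N a b Pinv Q W aa bb).

Lemma atk_lt_gap j : (j < N)%N -> bb j < aa j.+1.
Proof. by move=> jN; apply: (atk_lt_ba hatk (j := j.+1)). Qed.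

Lemma atk_le_ab i : (i <= N)%N -> aa i <= bb i.
Proof. by move=> iN; exact/ltW/(atk_lt_ab hatk). Qed.

Lemma atk_ge_left i : (i <= N)%N -> a <= aa i.
Proof.
elim: i => [_|i IH iN]; first by rewrite (atk_left hatk).
apply: (le_trans (IH (ltnW iN))); apply: (le_trans (atk_le_ab (ltnW iN))).
exact/ltW/atk_lt_gap.
Qed.

Lemma atk_le_right i : (i <= N)%N -> bb i <= b.
Proof.
move=> iN; rewrite -(atk_right hatk) -(subnKC iN).
have : (i + (N - i) <= N)%N by rewrite subnKC.
elim: (N - i)%N => [|k IH]; first by rewrite addn0.
rewrite addnS => ikN; apply: (le_trans (IH (ltnW ikN))).
by apply: (le_trans (ltW (atk_lt_gap ikN))); exact: atk_le_ab.
Qed.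

Lemma atk_lt_ba_far i j : (i < j)%N -> (j <= N)%N -> bb i < aa j.
Proof.
elim: j => // j IH; rewrite ltnS leq_eqVlt => /predU1P[->|ij] jN.
  exact: atk_lt_gap.
apply: (lt_trans (IH ij (ltnW jN))); apply: (lt_trans _ (atk_lt_gap jN)).
by apply: (atk_lt_ab hatk); exact: ltnW.
Qed.

Lemma atk_lt_ab_far i j : (i <= j)%N -> (j <= N)%N -> aa i < bb j.
Proof.
rewrite leq_eqVlt => /predU1P[->|ij] jN; first exact: (atk_lt_ab hatk).
apply: (lt_trans (atk_lt_ab hatk (leq_trans (ltnW ij) jN))).
by apply: (lt_trans (atk_lt_ba_far ij jN)); exact: (atk_lt_ab hatk).
Qed.

Lemma atk_cover t : a <= t <= b ->
  (exists2 i, (i <= N)%N & aa i <= t <= bb i) \/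
  (exists2 j, (j < N)%N & bb j <= t <= aa j.+1).
Proof.
move=> /andP[at_]; rewrite -(atk_right hatk).
elim: {1 3}N (leqnn N) => [_|k IH kN] tk.
  by left; exists 0%N => //; rewrite (atk_left hatk) at_.
have [tbk|bkt] := leP t (bb k); first by apply: IH => //; exact: ltnW.
have [ta|a_t] := leP t (aa k.+1).
  by right; exists k => //; rewrite (ltW bkt).
by left; exists k.+1 => //; rewrite (ltW a_t).
Qed.

End AtkinsonPartition.

(** * Coefficients of the discrete problem *)

Section AtkinsonSystem.
Local Open Scope classical_set_scope.
Context {R : realType}.
Notation mu := (@lebesgue_measure R).
Notation borel := ((R.-ocitv.-measurable).-sigma.-measurable).
Context (d N : nat) (a b : R) (Pinv Q W : R -> 'M[R[i]]_d) (aa bb : nat -> R).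
Context (hsl : sl_equation a b Pinv Q W).
Context (hatk : atkinson_partition N a b Pinv Q W aa bb).
Notation P_ := (atkP N Pinv aa bb).
Notation Q_ := (atkM Q aa bb).
Notation W_ := (atkM W aa bb).
Implicit Types (lambda : R[i]) (U : int -> 'cV[R[i]]_d).

Lemma Delta_nat U (j : nat) : Delta U j%:Z = U j.+1%:Z - U j%:Z.
Proof. by rewrite /Delta -(PoszD j 1) addn1. Qed.

Lemma Delta_natB1 U (j : nat) : Delta U (j.+1%:Z - 1) = U j.+1%:Z - U j%:Z.
Proof. by rewrite -Delta_nat -(addn1 j) PoszD addrK. Qed.

Lemma DeltaN1 U : Delta U (- 1) = U 0 - U (- 1).
Proof. by rewrite /Delta addNr. Qed.

Lemma atkP_gap j : (j < N)%N ->
  P_ j.+1 = invmx (mx_integral `[bb j, aa j.+1] Pinv).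
Proof. by move=> jN; rewrite /atkP /= jN. Qed.

Lemma atkP0 : P_ 0 = 1%:M. Proof. by []. Qed.

Lemma atkPN : P_ N.+1 = 1%:M. Proof. by rewrite /atkP /= ltnn. Qed.

Lemma atk_Pinv_unit j : (j < N)%N -> mx_integral `[bb j, aa j.+1] Pinv \in unitmx.
Proof. by move=> jN; apply: (atk_unit hatk (j := j.+1)). Qed.

Lemma gap_ge_left j : (j < N)%N -> a <= bb j.
Proof.
move=> jN; apply: (le_trans (atk_ge_left hatk (ltnW jN))).
by apply: (atk_le_ab hatk); exact: ltnW.
Qed.

Lemma gap_le_right j : (j < N)%N -> aa j.+1 <= b.
Proof.
by move=> jN; apply: (le_trans (atk_le_ab hatk jN)); exact: (atk_le_right hatk).
Qed.

Lemma sl_integrable_sub s t : a <= s -> t <= b ->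
  [/\ mx_integrable `[s, t] Pinv, mx_integrable `[s, t] Q &
      mx_integrable `[s, t] W].
Proof.
move=> as_ tb.
have sub (F : R -> 'M[R[i]]_d) : mx_integrable `]a, b[ F -> mx_integrable `[s, t] F.
  by move=> /mx_integrable_closed_itv; exact: mx_integrable_subitv.
by case: hsl => ? ? ? _; split; exact: sub.
Qed.

(** The coefficients are only assumed Hermitian inside the open interval, but
    its two end points are negligible. *)
Lemma sl_hermitian_sub s t : a <= s -> t <= b ->
  [/\ mx_integral `[s, t] Pinv \is hermsymmx,
      mx_integral `[s, t] Q \is hermsymmx &
      mx_integral `[s, t] W \is hermsymmx].
Proof.
move=> as_ tb; have [iP iQ iW] := sl_integrable_sub as_ tb.
have hae : \forall x \ae mu, `[s, t] x ->
    [/\ Pinv x \is hermsymmx, Q x \is hermsymmx & W x \is hermsymmx].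
  have ne (c : R) : \forall x \ae mu, x != c.
    exists [set c]; split => //; first exact: lebesgue_measure_set1.
    by move=> x /= /negP; rewrite negbK => /eqP.
  apply: ae_imply2 (ne a) _; first last.
    by apply: ae_imply2 (ne b) (sl_hermitian hsl) => x; exact: conj.
  move=> x xa [xb h]; rewrite /= in_itv/= => /andP[sx xt]; apply: h.
  by rewrite !lt_def xa eq_sym xb (le_trans as_ sx) (le_trans xt tb).
split; apply: mx_integral_hermsym => //.
- by apply: ae_imply hae => x /[apply] -[].
- by apply: ae_imply hae => x /[apply] -[].
- by apply: ae_imply hae => x /[apply] -[].
Qed.

Lemma atk_self_adjoint_coefficients :
  [/\ forall j, (j <= N.+1)%N -> P_ j \is hermsymmx /\ P_ j \in unitmx,
      forall i, (i <= N)%N -> Q_ i \is hermsymmx &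
      forall i, (i <= N)%N -> posdefmx (W_ i)].
Proof.
split.
- move=> [|j]; first by rewrite atkP0 unitmx1 hermitian1mx_subproof.
  rewrite ltnS leq_eqVlt => /predU1P[->|jN].
    by rewrite atkPN unitmx1 hermitian1mx_subproof.
  rewrite atkP_gap// unitmx_inv atk_Pinv_unit//; split => //.
  apply: hermsymmx_inv.
  by have [hP _ _] := sl_hermitian_sub (gap_ge_left jN) (gap_le_right jN); exact: hP.
- move=> i iN.
  have [_ hQ _] := sl_hermitian_sub (atk_ge_left hatk iN) (atk_le_right hatk iN).
  exact: hQ.
- exact: (atk_posdef hatk).
Qed.

Lemma block_integrable i lambda (c : 'cV[R[i]]_d) : (i <= N)%N ->
  mx_integrable `[aa i, bb i] (fun t => (Q t - lambda *: W t) *m c).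
Proof.
move=> iN.
have [_ iQ iW] := sl_integrable_sub (atk_ge_left hatk iN) (atk_le_right hatk iN).
by apply: mx_integrableMr => //; exact: mx_integrable_subZ.
Qed.

Lemma block_integral i lambda (c : 'cV[R[i]]_d) : (i <= N)%N ->
  mx_integral `[aa i, bb i] (fun t => (Q t - lambda *: W t) *m c) =
  (Q_ i - lambda *: W_ i) *m c.
Proof.
move=> iN.
have [_ iQ iW] := sl_integrable_sub (atk_ge_left hatk iN) (atk_le_right hatk iN).
by rewrite mx_integralMr// ?mx_integral_subZ//; exact: mx_integrable_subZ.
Qed.

(** * From the system to the difference equation *)

Section Discretization.
Context (lambda : R[i]) (u v : R -> 'cV[R[i]]_d).
Context (huv : sl_solution a b Pinv Q W lambda u v).

Lemma sol_u_block i s t : (i <= N)%N -> aa i <= s <= bb i -> aa i <= t <= bb i ->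
  u s = u t.
Proof.
move=> iN; wlog st : s t / s <= t.
  move=> hw hs ht; have [st|/ltW ts] := leP s t; first exact: hw.
  by apply/esym; exact: hw.
move=> /andP[as_ _] /andP[_ tb].
apply/esym/eqP; rewrite -subr_eq0; apply/eqP.
rewrite (mx_abs_cont_FTC _ st _ (sol_u_ac huv) (sol_u_eq huv) (G := fun=> 0)).
- exact: mx_integral0.
- exact: le_trans (atk_ge_left hatk iN) as_.
- exact: le_trans tb (atk_le_right hatk iN).
- apply: ae_imply (atk_Pinv0 hatk iN) => x h /andP[sx xt].
  by rewrite h ?mul0mx// (le_trans as_ sx) (le_trans xt tb).
- exact: mx_integrable0.
Qed.

Lemma sol_v_block i : (i <= N)%N ->
  v (bb i) - v (aa i) = (Q_ i - lambda *: W_ i) *m u (aa i).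
Proof.
move=> iN; rewrite -block_integral//.
apply: (mx_abs_cont_FTC _ _ _ (sol_v_ac huv) (sol_v_eq huv)).
- exact: (atk_ge_left hatk).
- exact: (atk_le_ab hatk).
- exact: (atk_le_right hatk).
- apply: aeW => x xab; rewrite (sol_u_block iN xab (t := aa i))//.
  by rewrite lexx (atk_le_ab hatk).
- exact: block_integrable.
Qed.

Lemma sol_v_gap j t : (j < N)%N -> bb j <= t <= aa j.+1 -> v t = v (bb j).
Proof.
move=> jN /andP[bt ta]; apply/eqP; rewrite -subr_eq0; apply/eqP.
rewrite (mx_abs_cont_FTC _ bt _ (sol_v_ac huv) (sol_v_eq huv) (G := fun=> 0)).
- exact: mx_integral0.
- exact: gap_ge_left.
- exact: le_trans ta (gap_le_right jN).
- apply: ae_imply (atk_QW0 hatk (j := j.+1) jN) => x h /andP[sx xt].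
  have [-> ->] : Q x = 0 /\ W x = 0 by apply: h; rewrite /= sx (le_trans xt ta).
  by rewrite scaler0 subrr mul0mx.
- exact: mx_integrable0.
Qed.

Lemma sol_u_gap j : (j < N)%N ->
  u (aa j.+1) - u (bb j) = mx_integral `[bb j, aa j.+1] Pinv *m v (bb j).
Proof.
move=> jN.
have [iP _ _] := sl_integrable_sub (gap_ge_left jN) (gap_le_right jN).
rewrite -mx_integralMr//.
apply: (mx_abs_cont_FTC _ _ _ (sol_u_ac huv) (sol_u_eq huv)).
- exact: gap_ge_left.
- exact/ltW/(atk_lt_gap hatk).
- exact: gap_le_right.
- by apply: aeW => x /(sol_v_gap jN) ->.
- exact: mx_integrableMr.
Qed.

Lemma discretizes_exists : exists U, discretizes N a b aa bb u v U.
Proof.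
exists (fun z => match z with
  | Posz i => if (i <= N)%N then u (aa i) else u b + v b
  | Negz _ => u a - v a end).
split => [i iN t tab /=||/=].
- by rewrite iN; apply: (sol_u_block iN) => //; rewrite lexx (atk_le_ab hatk).
- by rewrite /= (atk_left hatk).
rewrite ltnn leqnn; congr (_ + _).
rewrite -{1}(atk_right hatk); apply: (sol_u_block (leqnn N)).
  by rewrite lexx (atk_le_ab hatk).
by rewrite lexx (atk_le_ab hatk).
Qed.

Context (U : int -> 'cV[R[i]]_d) (hU : discretizes N a b aa bb u v U).

Lemma discretizes_aa i : (i <= N)%N -> u (aa i) = U i%:Z.
Proof. by case: hU => h _ _ iN; apply: (h i iN); rewrite lexx (atk_le_ab hatk). Qed.

Lemma discretizes_bb i : (i <= N)%N -> u (bb i) = U i%:Z.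
Proof. by case: hU => h _ _ iN; apply: (h i iN); rewrite lexx (atk_le_ab hatk). Qed.

(** On the gap after block i the flux is constant and determines the increment
    of u, so it is recovered by inverting the integral of P^-1; at i = N this
    is the choice of the ghost value u_(N+1). *)
Lemma discretizes_flux_bb i : (i <= N)%N -> P_ i.+1 *m Delta U i%:Z = v (bb i).
Proof.
rewrite leq_eqVlt Delta_nat => /predU1P[->|iN].
  case: hU => _ _ ->; rewrite atkPN mul1mx (atk_right hatk).
  by rewrite addrC addKr.
rewrite -(discretizes_aa iN) -(discretizes_bb (ltnW iN)) sol_u_gap//.
by rewrite atkP_gap// mulKmx// atk_Pinv_unit.
Qed.

Lemma discretizes_flux_aa i : (i <= N)%N -> P_ i *m Delta U (i%:Z - 1) = v (aa i).
Proof.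
case: i => [_|i iN].
  case: hU => _ UN1 _; rewrite atkP0 mul1mx sub0r DeltaN1 UN1 (atk_left hatk).
  by rewrite opprB addrC subrK.
rewrite Delta_natB1 -Delta_nat discretizes_flux_bb; last exact: ltnW.
by rewrite (sol_v_gap iN)// lexx (ltW (atk_lt_gap hatk iN)).
Qed.

Lemma discretizes_equation : discrete_equation N P_ Q_ W_ lambda U.
Proof.
move=> i iN; rewrite discretizes_flux_bb// discretizes_flux_aa//.
rewrite sol_v_block// discretizes_aa// mulmxBl -scalemxAl.
by rewrite opprB subrK.
Qed.

Lemma discretizes_bc (A B : 'M[R[i]]_(d + d)) :
  bc A B (u a) (u b) (v a) (v b) <-> discrete_bc N A B U.
Proof.
rewrite /discrete_bc DeltaN1 Delta_nat.
rewrite -(discretizes_aa (leq0n N)) -(discretizes_bb (leqnn N)).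
case: hU => _ -> ->.
rewrite -(discretizes_aa (leq0n N)) -(discretizes_bb (leqnn N)).
by rewrite (atk_left hatk) (atk_right hatk) opprB addrC subrK addrAC subrr add0r.
Qed.

End Discretization.

(** * From the difference equation to the system *)

Section Reconstruction.
Context (lambda : R[i]) (U : int -> 'cV[R[i]]_d).
Context (hU : discrete_equation N P_ Q_ W_ lambda U).

(* The value of v that the sequence prescribes on the gap before block j; for
   j = 0 and j = N + 1 it is the value prescribed at a and at b. *)
Let flux (j : nat) := P_ j *m Delta U (j%:Z - 1).

(* The right-hand sides of the system, with u replaced by U i on block i and v
   by the flux on each gap. The terms Pinv v on blocks and (Q - lambda W) u on
   gaps are left out since they vanish almost everywhere. *)
Let u' t := \sum_(j < N)
  (if bb j <= t <= aa j.+1 then Pinv t *m flux j.+1 else 0).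

Let v' t := \sum_(i < N.+1)
  (if aa i <= t <= bb i then (Q t - lambda *: W t) *m U i%:Z else 0).

Definition u_of_seq t := U 0 + mx_integral `[a, t] u'.

Definition v_of_seq t := Delta U (- 1) + mx_integral `[a, t] v'.

Let fluxE i : (i <= N)%N ->
  flux i.+1 - flux i = (Q_ i - lambda *: W_ i) *m U i%:Z.
Proof.
move=> iN; rewrite mulmxBl -scalemxAl -(hU iN) /flux Delta_natB1 -Delta_nat.
by rewrite opprD opprK addrCA subrr addr0.
Qed.

Let iu' : mx_integrable `[a, b] u'.
Proof.
have [iP _ _] := sl_integrable_sub (lexx a) (lexx b).
apply: mx_integrable_sum => // j; apply: mx_integrable_if => //.
exact: mx_integrableMr.
Qed.

Let iv' : mx_integrable `[a, b] v'.
Proof.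
have [_ iQ iW] := sl_integrable_sub (lexx a) (lexx b).
apply: mx_integrable_sum => // j; apply: mx_integrable_if => //.
by apply: mx_integrableMr => //; exact: mx_integrable_subZ.
Qed.

Let u'_block i t : (i <= N)%N -> aa i <= t <= bb i -> Pinv t = 0 -> u' t = 0.
Proof. by move=> iN tab Pt; apply: big1 => j _; case: ifP; rewrite ?Pt ?mul0mx. Qed.

Let v'_gap t : Q t = 0 /\ W t = 0 -> v' t = 0.
Proof.
move=> [Qt Wt]; apply: big1 => j _; case: ifP => //.
by rewrite Qt Wt scaler0 subrr mul0mx.
Qed.

Let u'_gap j t : (j < N)%N -> bb j <= t <= aa j.+1 ->
  u' t = Pinv t *m flux j.+1.
Proof.
move=> jN tj; rewrite /u' (bigD1 (Ordinal jN))//= tj big1 ?addr0// => k kj.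
case: ifP => // /andP[bk ka]; move: tj => /andP[bj ja].
have [kj'|jk|kj'] := ltngtP k j.
- have := atk_lt_ab_far hatk kj' (ltnW jN).
  by rewrite ltNge (le_trans bj ka).
- have := atk_lt_ab_far hatk jk (ltnW (ltn_ord k)).
  by rewrite ltNge (le_trans bk ja).
- by move: kj; rewrite -val_eqE /= kj' eqxx.
Qed.

Let v'_block i t : (i <= N)%N -> aa i <= t <= bb i ->
  v' t = (Q t - lambda *: W t) *m U i%:Z.
Proof.
rewrite -ltnS => iN ti; rewrite /v' (bigD1 (Ordinal iN))//= ti big1 ?addr0// => k ki.
case: ifP => // /andP[ak kb]; move: ti => /andP[ai ib].
have [ki'|ik|ki'] := ltngtP k i.
- have := atk_lt_ba_far hatk ki' iN.
  by rewrite ltNge (le_trans ai kb).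
- have := atk_lt_ba_far hatk ik (ltn_ord k).
  by rewrite ltNge (le_trans ak ib).
- by move: ki; rewrite -val_eqE /= ki' eqxx.
Qed.

Let u_incr s t : a <= s -> s <= t -> t <= b ->
  u_of_seq t - u_of_seq s = mx_integral `[s, t] u'.
Proof.
move=> as_ st tb; rewrite -(mx_integral_itv_sub as_ st tb iu').
by rewrite /u_of_seq opprD addrACA subrr add0r.
Qed.

Let v_incr s t : a <= s -> s <= t -> t <= b ->
  v_of_seq t - v_of_seq s = mx_integral `[s, t] v'.
Proof.
move=> as_ st tb; rewrite -(mx_integral_itv_sub as_ st tb iv').
by rewrite /v_of_seq opprD addrACA subrr add0r.
Qed.

Let u_block i t : (i <= N)%N -> aa i <= t <= bb i ->
  u_of_seq t = u_of_seq (aa i).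
Proof.
move=> iN /andP[at_ tb]; apply/eqP; rewrite -subr_eq0; apply/eqP.
have ai := atk_ge_left hatk iN; have tb' := le_trans tb (atk_le_right hatk iN).
rewrite u_incr//.
rewrite (mx_integral_ae (G := fun=> 0))//; first exact: mx_integral0.
- exact: mx_integrable_subitv iu'.
- exact: mx_integrable0.
apply: ae_imply (atk_Pinv0 hatk iN) => x h; rewrite /= in_itv/= => /andP[ax xt].
have xi : aa i <= x <= bb i by rewrite ax (le_trans xt tb).
exact: (u'_block iN xi (h xi)).
Qed.

Let v_gap j t : (j < N)%N -> bb j <= t <= aa j.+1 ->
  v_of_seq t = v_of_seq (bb j).
Proof.
move=> jN /andP[bt ta]; apply/eqP; rewrite -subr_eq0; apply/eqP.
have bj := gap_ge_left jN; have tb := le_trans ta (gap_le_right jN).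
rewrite v_incr//.
rewrite (mx_integral_ae (G := fun=> 0))//; first exact: mx_integral0.
- exact: mx_integrable_subitv iv'.
- exact: mx_integrable0.
apply: ae_imply (atk_QW0 hatk (j := j.+1) jN) => x h.
rewrite /= in_itv/= => /andP[bx xt].
by apply: v'_gap; apply: h; rewrite bx (le_trans xt ta).
Qed.

Let u_gap j : (j < N)%N -> u_of_seq (aa j.+1) - u_of_seq (bb j) = Delta U j%:Z.
Proof.
move=> jN.
have [iP _ _] := sl_integrable_sub (gap_ge_left jN) (gap_le_right jN).
have bj := gap_ge_left jN; have ja := gap_le_right jN.
rewrite u_incr//; last exact/ltW/(atk_lt_gap hatk).
rewrite (mx_integral_ae (G := fun t => Pinv t *m flux j.+1))//.
- rewrite mx_integralMr// /flux Delta_natB1 -Delta_nat atkP_gap//.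
  by rewrite mulKVmx// atk_Pinv_unit.
- exact: mx_integrable_subitv iu'.
- exact: mx_integrableMr.
by apply: aeW => x; rewrite /= in_itv/=; exact: u'_gap.
Qed.

Let v_block i : (i <= N)%N ->
  v_of_seq (bb i) - v_of_seq (aa i) = flux i.+1 - flux i.
Proof.
move=> iN; have ai := atk_ge_left hatk iN; have ib := atk_le_right hatk iN.
rewrite v_incr//; last exact: (atk_le_ab hatk).
rewrite fluxE// -block_integral//; apply: mx_integral_ae => //.
- exact: mx_integrable_subitv iv'.
- exact: block_integrable.
by apply: aeW => x; rewrite /= in_itv/=; exact: v'_block.
Qed.

(* The two functions are followed along the partition: over block i the flux
   changes by the difference equation, over the next gap u changes by Delta U i. *)
Let uv_aa i : (i <= N)%N ->
  u_of_seq (aa i) = U i%:Z /\ v_of_seq (aa i) = flux i.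
Proof.
elim: i => [_|i IH iN].
  rewrite (atk_left hatk) /u_of_seq /v_of_seq !mx_integral_itv1 !addr0; split => //.
  by rewrite /flux atkP0 mul1mx sub0r.
have [uE vE] := IH (ltnW iN).
have ab_i : aa i <= bb i <= bb i by rewrite lexx (atk_le_ab hatk (ltnW iN)).
split.
  rewrite -[LHS](subrK (u_of_seq (bb i))) u_gap// (u_block (ltnW iN) ab_i) uE.
  by rewrite Delta_nat subrK.
rewrite (v_gap iN); last by rewrite lexx (ltW (atk_lt_gap hatk iN)).
by rewrite -[LHS](subrK (v_of_seq (aa i))) v_block ?(ltnW iN)// vE subrK.
Qed.

Let v_bb i : (i <= N)%N -> v_of_seq (bb i) = flux i.+1.
Proof.
move=> iN; have [_ vE] := uv_aa iN.
by rewrite -[LHS](subrK (v_of_seq (aa i))) v_block// vE subrK.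
Qed.

Lemma seq_sl_solution : sl_solution a b Pinv Q W lambda u_of_seq v_of_seq.
Proof.
have P0 : \forall t \ae mu, forall i, (i <= N)%N -> aa i <= t <= bb i -> Pinv t = 0.
  apply: ae_countable => i; have [iN|] := leqP i N; last by move=> ?; exact: aeW.
  by apply: ae_imply (atk_Pinv0 hatk iN).
have QW0 : \forall t \ae mu, forall j, (j < N)%N -> bb j <= t <= aa j.+1 ->
    Q t = 0 /\ W t = 0.
  apply: ae_countable => j; have [jN|] := ltnP j N; last by move=> ?; exact: aeW.
  by apply: ae_imply (atk_QW0 hatk (j := j.+1) jN).
split.
- exact: mx_abs_cont_primitive.
- exact: mx_abs_cont_primitive.
- apply: ae_imply2 P0 (mx_is_derive_primitive (U 0) iu') => t P0t dt tab.
  suff <- : u' t = Pinv t *m v_of_seq t by exact: dt.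
  have [|[i iN ti]|[j jN tj]] := atk_cover hatk (t := t).
  + by case/andP: tab => at_ tb; rewrite !ltW.
  + by rewrite (P0t i iN ti) mul0mx; apply: (u'_block iN ti); exact: P0t ti.
  + by rewrite (u'_gap jN tj) (v_gap jN tj) v_bb// ltnW.
- apply: ae_imply2 QW0 (mx_is_derive_primitive (Delta U (- 1)) iv') => t QW0t dt tab.
  suff <- : v' t = (Q t - lambda *: W t) *m u_of_seq t by exact: dt.
  have [|[i iN ti]|[j jN tj]] := atk_cover hatk (t := t).
  + by case/andP: tab => at_ tb; rewrite !ltW.
  + by rewrite (v'_block iN ti) (u_block iN ti); have [-> _] := uv_aa iN.
  + have [Qt Wt] := QW0t j jN tj.
    by rewrite v'_gap// Qt Wt scaler0 subrr mul0mx.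
Qed.

Lemma seq_discretizes : discretizes N a b aa bb u_of_seq v_of_seq U.
Proof.
split.
- by move=> i iN t ti; rewrite (u_block iN ti); have [] := uv_aa iN.
- have [_] := uv_aa (leq0n N); rewrite (atk_left hatk) => ->.
  by rewrite /flux atkP0 mul1mx sub0r DeltaN1 opprB addrCA subrr addr0.
- rewrite -{1}(atk_right hatk) v_bb// /flux atkPN mul1mx Delta_natB1.
  by rewrite addrCA subrr addr0.
Qed.

End Reconstruction.

End AtkinsonSystem.

(** * The equivalence *)

Theorem lemma5p1 (R : realType) (d N : nat) (hd : (1 <= d)%N) (hN : (1 < N)%N)
    (a b : R) (Pinv Q W : R -> 'M[R[i]]_d) (aa bb : nat -> R)
    (hsl : sl_equation a b Pinv Q W)
    (hatk : atkinson_partition N a b Pinv Q W aa bb)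
    (A1 A2 B1 B2 : 'M[R[i]]_(d + d, d))
    (hbc : self_adjoint_bc (row_mx A1 A2) (row_mx B1 B2)) :
  let A := row_mx A1 A2 in
  let B := row_mx B1 B2 in
  let P_ := atkP N Pinv aa bb in
  let Q_ := atkM Q aa bb in
  let W_ := atkM W aa bb in
  ((forall U : int -> 'cV[R[i]]_d,
      discrete_bc N A B U <->
      standard_discrete_bc N A (row_mx (B1 - A1) B2) U) /\
   self_adjoint_discrete_slp N P_ Q_ W_ A (row_mx (B1 - A1) B2)) /\
  (forall lambda : R[i],
     (forall u v : R -> 'cV[R[i]]_d,
        continuous_problem a b Pinv Q W A B lambda u v ->
        (forall i : nat, (i <= N)%N ->
           forall s t, aa i <= s <= bb i -> aa i <= t <= bb i -> u s = u t) /\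
        (exists2 U : int -> 'cV[R[i]]_d,
           discretizes N a b aa bb u v U &
           discrete_problem N P_ Q_ W_ A B lambda U) /\
        (forall U : int -> 'cV[R[i]]_d,
           discretizes N a b aa bb u v U ->
           discrete_problem N P_ Q_ W_ A B lambda U)) /\
     (forall U : int -> 'cV[R[i]]_d,
        discrete_problem N P_ Q_ W_ A B lambda U ->
        exists u v : R -> 'cV[R[i]]_d,
          continuous_problem a b Pinv Q W A B lambda u v /\
          discretizes N a b aa bb u v U)).
Proof.
move=> A B P_ Q_ W_; split.
  split; first by move=> U; exact: standard_discrete_bcE.
  have [hP hQ hW] := atk_self_adjoint_coefficients hsl hatk.
  by split => //; exact: self_adjoint_bc_standard.
move=> lambda; split.
  move=> u v [huv buv]; split.
    by move=> i iN s t; exact: (sol_u_block hatk huv iN).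
  have disc U : discretizes N a b aa bb u v U ->
      discrete_problem N P_ Q_ W_ A B lambda U.
    move=> hU; split; first exact: (discretizes_equation hsl hatk huv hU).
    exact/(discretizes_bc hatk hU).
  split; last exact: disc.
  have [U hU] := discretizes_exists hatk huv.
  by exists U => //; exact: disc.
move=> U [eU bU].
have hU := seq_discretizes hsl hatk eU.
exists (u_of_seq N a Pinv aa bb U), (v_of_seq N a Q W aa bb lambda U).
split => //; split; first exact: (seq_sl_solution hsl hatk eU).
exact/(discretizes_bc hatk hU).
Qed.
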